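(* Let $\mathbb{K}$ be a field with $\operatorname{char}\mathbb{K}\neq 2$, let $2\le m\le n$ be integers, and let $H$ be the $m\times n$ generic Hankel matrix over $\mathbb{K}$. Assume that one of the following holds: (1) $m=2$ and $n\ge 4$; (2) $(m,n)=(3,4)$; (3) $(m,n)=(3,5)$; (4) $(m,n)=(4,4)$. Then $\operatorname{v}(P_2(H))=2$.
   Context: The $m\times n$ generic Hankel matrix over $\mathbb{K}$ is $H=(h_{ij})$ with $h_{ij}=x_{i+j-1}$ for $1\le i\le m$, $1\le j\le n$, where $x_1,\dots,x_{m+n-1}$ are algebraically independent indeterminates; we work in the standard graded polynomial ring $R=\mathbb{K}[x_1,\dots,x_{m+n-1}]$. $P_2(H)\subseteq R$ denotes the $2\times 2$ permanental ideal of $H$: the ideal generated by all $2\times2$ subpermanents $h_{ik}h_{jl}+h_{il}h_{jk}$ with $1\le i<j\le m$, $1\le k<l\le n$. For a graded ideal $I$ of a standard graded polynomial ring $R=\bigoplus_{d\ge0}R_d$ over a field, the $\operatorname{v}$-number of $I$ is $$\operatorname{v}(I)=\min\{d\mid \text{there exist } f\in R_d \text{ and } \mathfrak{p}\in\operatorname{Ass}(I)\text{ such that } (I:f)=\mathfrak{p}\},$$ where $\operatorname{Ass}(I)$ is the set of associated primes of $R/I$ and $(I:f)=\{g\in R\mid gf\in I\}$. *)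

(* Defs.v *)
From HB Require Import structures.
From mathcomp Require Import all_boot all_order all_algebra.
From mathcomp Require Import boolp.
From mathcomp Require Import mpoly.
From mathcomp Require Import zify.

Set Implicit Arguments.
Unset Strict Implicit.
Unset Printing Implicit Defensive.

Import GRing.Theory.
Local Open Scope ring_scope.

(* Ideals are boolean predicates, made so by classical logic ([`[< _ >]]), so
   that [idealr_closed] and [prime_idealr_closed] of ring_quotient apply. *)

Definition ideal_gen (R : comNzRingType) (G : R -> Prop) : {pred R} :=
  fun x => `[< exists s : seq (R * R),
    (forall q, q \in s -> G q.2) /\ x = \sum_(q <- s) q.1 * q.2 >].

Definition colon (R : comNzRingType) (I : {pred R}) (f : R) : {pred R} :=
  fun g => g * f \in I.

(* [idealr_closed p] includes [1 \notin p]: prime ideals are proper. *)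
Definition prime_ideal (R : comNzRingType) (p : {pred R}) : Prop :=
  idealr_closed p /\ prime_idealr_closed p.

(* [colon I x] is the annihilator of the class of x in R / I. *)
Definition associated_prime (R : comNzRingType) (I p : {pred R}) : Prop :=
  prime_ideal p /\ exists x : R, p =i colon I x.

Definition v_degree (N : nat) (K : fieldType) (I : {pred {mpoly K[N]}})
    (d : nat) : Prop :=
  exists (f : {mpoly K[N]}) (p : {pred {mpoly K[N]}}),
    [/\ f \is d.-homog, associated_prime I p & colon I f =i p].

(* The value 0 for an empty set of degrees (as for I = R) is a dummy. *)
Definition v_number (N : nat) (K : fieldType) (I : {pred {mpoly K[N]}}) : nat :=
  if pselect (exists d, `[< v_degree I d >]) is left ex_d
  then ex_minn ex_d else 0%N.

Lemma hankel_index_subproof (m n : nat) (i : 'I_m) (j : 'I_n) :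
  (i + j < m + n - 1)%N.
Proof. by have := ltn_ord i; have := ltn_ord j; lia. Qed.

Definition hankel_index (m n : nat) (i : 'I_m) (j : 'I_n) : 'I_(m + n - 1) :=
  Ordinal (hankel_index_subproof i j).

(* Indices start at 0: the variable 'X_k is x_(k+1), and entry (i, j) is
   x_((i+1) + (j+1) - 1) = 'X_(i + j). *)
Definition hankel (K : fieldType) (m n : nat) :
    'M[{mpoly K[m + n - 1]}]_(m, n) :=
  \matrix_(i < m, j < n) 'X_(hankel_index i j).

Definition permanental_ideal2 (R : comNzRingType) (m n : nat)
    (A : 'M[R]_(m, n)) : {pred R} :=
  ideal_gen (fun x => exists (i j : 'I_m) (k l : 'I_n),
    [/\ (i < j)%N, (k < l)%N & x = A i k * A j l + A i l * A j k]).

(* Main.v *)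
(* Number the variables x_0, ..., x_(N-1) with N = m + n - 1, and give x_i
   weight i; the ideal I is homogeneous for degree and weight.

   Lower bound.  A prime containing I contains x_1, ..., x_(N-2), because these
   are nilpotent modulo I, and it contains x_0 or x_(N-1).  If (I : f) is such
   a prime and f is linear, x_i f lies in I for every x_i in the prime.  In each
   weight that matters, a linear functional with alternating values +-1 on the
   quadratic monomials kills I, so every coefficient of f is 0.

   Upper bound.  The class of x_2^2 if m = 2, and of x_2 x_3 if n = 4 and
   m = 3 or 4, is a nonzero socle element, so the colon ideal is the
   homogeneous maximal ideal.  For (m, n) = (3, 5) take x_0 x_3: its colon
   ideal is (x_1, ..., x_6), where no power of x_0 kills it because
   x_0 x_3 |-> t^2 s^3 for the map x_i |-> +- t s^i to K[t, s] / (s^4), which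
   vanishes on I. *)

From HB Require Import structures.
Require Import Defs.
From mathcomp Require Import all_boot all_order all_algebra.
From mathcomp Require Import mpoly.
From mathcomp Require Import boolp zify ring.

Set Implicit Arguments.
Unset Strict Implicit.
Unset Printing Implicit Defensive.

Import GRing.Theory.
Local Open Scope ring_scope.

(** * Ideals, colon ideals and generated ideals *)

Lemma in_colon (R : comNzRingType) (J : {pred R}) (f g : R) :
  (g \in colon J f) = (g * f \in J).
Proof. by []. Qed.

(** Unlike [idealr_closed], this allows the unit ideal, which a colon ideal can be. *)
Definition is_ideal (R : comNzRingType) (J : {pred R}) : Prop :=
  0 \in J /\ forall a u v, u \in J -> v \in J -> a * u + v \in J.

Section Ideals.
Variables (R : comNzRingType) (J : {pred R}).
Hypothesis idealJ : is_ideal J.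

Lemma ideal0 : 0 \in J. Proof. by case: idealJ. Qed.

Lemma idealMl a u : u \in J -> a * u \in J.
Proof. by case: idealJ => J0 JD Ju; rewrite -[_ * _]addr0; apply: JD. Qed.

Lemma idealMr a u : u \in J -> u * a \in J.
Proof. by rewrite mulrC; exact: idealMl. Qed.

Lemma idealD u v : u \in J -> v \in J -> u + v \in J.
Proof. by case: idealJ => _ JD Ju Jv; rewrite -[u]mul1r; apply: JD. Qed.

Lemma idealN u : u \in J -> - u \in J.
Proof. by move=> Ju; rewrite -mulN1r idealMl. Qed.

Lemma idealB u v : u \in J -> v \in J -> u - v \in J.
Proof. by move=> Ju Jv; rewrite idealD ?idealN. Qed.

Lemma ideal_colon f : is_ideal (colon J f).
Proof.
split; first by rewrite in_colon mul0r ideal0.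
move=> a u v; rewrite !in_colon => Ju Jv.
by rewrite mulrDl -mulrA idealD // idealMl.
Qed.

End Ideals.

Section GeneratedIdeals.
Variables (R : comNzRingType) (G : R -> Prop).

Lemma ideal_gen_incl g : G g -> g \in ideal_gen G.
Proof.
move=> Gg; rewrite unfold_in; apply/asboolP; exists [:: (1, g)].
split; last by rewrite big_seq1 mul1r.
by move=> q; rewrite inE => /eqP ->.
Qed.

Lemma ideal_gen_ideal : is_ideal (ideal_gen G).
Proof.
split; first by rewrite unfold_in; apply/asboolP; exists [::]; rewrite big_nil.
move=> a u v; rewrite !unfold_in => /asboolP [s [Gs ->]] /asboolP [t [Gt ->]].
apply/asboolP; exists ([seq (a * q.1, q.2) | q <- s] ++ t); split.
  move=> q; rewrite mem_cat => /orP[/mapP[r rs ->]|]; last exact: Gt.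
  exact: Gs rs.
rewrite big_cat big_map mulr_sumr; congr (_ + _).
by apply: eq_bigr => q _; rewrite mulrA.
Qed.

Lemma ideal_gen_ind (P : R -> Prop) g :
  P 0 -> (forall a u v, G u -> P v -> P (a * u + v)) -> g \in ideal_gen G ->
  P g.
Proof.
move=> P0 PD; rewrite unfold_in => /asboolP [s [Gs ->]].
elim: s Gs => [|q s IHs] Gs; first by rewrite big_nil.
rewrite big_cons; apply: PD; first by apply: Gs; rewrite mem_head.
by apply: IHs => r rs; apply: Gs; rewrite in_cons rs orbT.
Qed.

End GeneratedIdeals.

(* Junk value: xvar K N k = 0 when N <= k. *)
Definition xvar (K : fieldType) (N k : nat) : {mpoly K[N]} :=
  if insub k is Some i then 'X_i else 0.

Lemma xvarE (K : fieldType) (N : nat) (i : 'I_N) : xvar K N i = 'X_i.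
Proof. by rewrite /xvar valK. Qed.

(** * Linear functionals on the quadratic part of a polynomial *)

Section QuadraticForms.
Variables (K : fieldType) (N : nat).
Implicit Types (c : nat -> nat -> K) (g q : {mpoly K[N]}).

(** The Hessian of [g] at the origin paired with [c]; for symmetric [c] it sends [x_i x_j] to
    [2 c i j]. *)
Definition quad c g : K :=
  \sum_(i < N) \sum_(j < N) c i j * (g^`M(i)^`M(j))@_0.

Definition symmetric2 c := forall i j, c i j = c j i.

Lemma quadD c g h : quad c (g + h) = quad c g + quad c h.
Proof.
rewrite /quad -big_split /=; apply: eq_bigr => i _.
rewrite -big_split /=; apply: eq_bigr => j _.
by rewrite !mderivD mcoeffD mulrDr.
Qed.

Lemma quad0 c : quad c 0 = 0.
Proof.
rewrite /quad big1 // => i _; rewrite big1 // => j _.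
by rewrite !mderiv0 mcoeff0 mulr0.
Qed.

Lemma mderivXU (i b : 'I_N) : ('X_b : {mpoly K[N]})^`M(i) = (b == i)%:R%:MP.
Proof.
rewrite mderivX mnm1E; case: eqP => [->|]; last by rewrite scale0r.
by rewrite -[X in (X - _)%MM]add0m addmK mpolyX0 scale1r.
Qed.

Lemma mcoeff0M (p q : {mpoly K[N]}) : (p * q)@_0%MM = p@_0%MM * q@_0%MM.
Proof. exact: rmorphM. Qed.

Lemma mcoeff0XU (b : 'I_N) : ('X_b : {mpoly K[N]})@_0%MM = 0.
Proof. by rewrite mcoeffX -mdeg_eq0 mdeg1. Qed.

Lemma quadXM c (b : 'I_N) q : symmetric2 c ->
  quad c ('X_b * q) = 2%:R * \sum_(j < N) c b j * q@_U_(j).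
Proof.
move=> c_sym.
have dq (j : 'I_N) : (q^`M(j))@_0 = q@_U_(j).
  by rewrite mcoeff_deriv add0m mnm0E.
have dE (i j : 'I_N) : (('X_b * q)^`M(i)^`M(j))@_0
    = (b == i)%:R * q@_U_(j) + (b == j)%:R * q@_U_(i).
  rewrite mderivM mderivXU mderivD !mderivM mderivC mul0r add0r mderivXU.
  rewrite !mcoeffD !mcoeff0M mcoeff0XU mul0r addr0.
  by rewrite !mcoeffC eqxx !mulr1 !dq.
have delta (F : 'I_N -> K) : \sum_(i < N) (b == i)%:R * F i = F b.
  rewrite (bigD1 b) //= eqxx mul1r big1 ?addr0 // => i /negbTE.
  by rewrite eq_sym => ->; rewrite mul0r.
rewrite /quad.
under eq_bigr => i _ do under eq_bigr => j _ do rewrite dE mulrDr.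
under eq_bigr => i _ do rewrite big_split /=.
rewrite big_split /= mulr2n mulrDl mul1r; congr (_ + _).
  rewrite -[RHS](delta (fun i => \sum_(j < N) c i j * q@_U_(j))).
  by apply: eq_bigr => i _; rewrite mulr_sumr; apply: eq_bigr => j _; ring.
apply: eq_bigr => i _; rewrite -[RHS](delta (fun j => c j i * q@_U_(i))).
by apply: eq_bigr => j _; rewrite (c_sym i j); ring.
Qed.

Lemma quadXX c (b d : 'I_N) : symmetric2 c ->
  quad c ('X_b * 'X_d) = 2%:R * c b d.
Proof.
move=> c_sym; rewrite quadXM // (bigD1 d) //= mcoeffXU eqxx mulr1.
rewrite big1 ?addr0 // => j /negbTE; rewrite eq_sym mcoeffXU => ->.
by rewrite mulr0.
Qed.

(** As [g] vanishes to order two at the origin, only the constant term of [a] reaches the quadratic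
    part of [a * g]. *)
Lemma quadMl c a g : g@_0%MM = 0 -> (forall i, (g^`M(i))@_0%MM = 0) ->
  quad c (a * g) = a@_0%MM * quad c g.
Proof.
move=> g0 dg0; rewrite /quad mulr_sumr; apply: eq_bigr => i _.
rewrite mulr_sumr; apply: eq_bigr => j _.
rewrite mderivM mderivD !mderivM !mcoeffD !mcoeff0M g0 !dg0; ring.
Qed.

End QuadraticForms.

(** * The permanental ideal of the Hankel matrix *)

Section Hankel.
Variables (K : fieldType) (m n : nat).
Local Notation N := (m + n - 1)%N.
Local Notation x := (xvar K N).
Local Notation I := (permanental_ideal2 (hankel K m n)).

Lemma hankel_ideal : is_ideal I.
Proof. exact: ideal_gen_ideal. Qed.

Lemma hankel_permanent i j k l : (i < j < m)%N -> (k < l < n)%N ->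
  x (i + k) * x (j + l) + x (i + l) * x (j + k) \in I.
Proof.
move=> /andP[ij jm] /andP[kl ln]; apply: ideal_gen_incl.
exists (Ordinal (ltn_trans ij jm)), (Ordinal jm).
exists (Ordinal (ltn_trans kl ln)), (Ordinal ln); split=> //.
by rewrite !mxE -!xvarE.
Qed.

Lemma hankel_adjacent k l : (2 <= m)%N -> (4 <= n)%N ->
  (k < l <= k + 3)%N -> (l.+1 < N)%N ->
  x k * x l.+1 + x k.+1 * x l \in I.
Proof.
(* Rows [i], [i + 1] and columns [k - i], [l - i]: with [i = k] the column bound follows from
   [l <= k + 3], with [i = m - 2] from [l + 1 < N]. *)
move=> m_ge2 n_ge4 kl lN; pose i := minn k (m - 2).
have hi : (i < i.+1 < m)%N by lia.
have hk : (k - i < l - i < n)%N by lia.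
have := hankel_permanent hi hk; rewrite !addSn !subnKC; try lia.
by rewrite [in X in _ + X]mulrC.
Qed.

Lemma hankel_ind (P : {mpoly K[N]} -> Prop) g : P 0 ->
  (forall a v i j k l, (i < j < m)%N -> (k < l < n)%N -> P v ->
     P (a * (x (i + k) * x (j + l) + x (i + l) * x (j + k)) + v)) ->
  g \in I -> P g.
Proof.
move=> P0 PD; apply: ideal_gen_ind => // a u v [i [j [k [l [ij kl ->]]]]] Pv.
by rewrite !mxE -!xvarE; apply: PD; rewrite // ?ij ?kl ltn_ord.
Qed.

Lemma mderiv_mcoeff0_hankel g i : g \in I -> (g^`M(i))@_0%MM = 0.
Proof.
have x0 k : (x k)@_0%MM = 0.
  by rewrite /xvar; case: insub => [b|]; rewrite ?mcoeff0XU ?mcoeff0.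
apply: (hankel_ind (P := fun g => _)) => [|a v j j' k l _ _ IHv].
  by rewrite mderiv0 mcoeff0.
rewrite mderivD mcoeffD IHv addr0 mderivM mderivD !mderivM.
by rewrite !(mcoeffD, mcoeff0M, x0, mulr0, mul0r, addr0).
Qed.

Lemma quad_hankel c g : symmetric2 c ->
  (forall i j k l, (i < j < m)%N -> (k < l < n)%N ->
     c (i + k)%N (j + l)%N + c (i + l)%N (j + k)%N = 0) ->
  g \in I -> quad c g = 0.
Proof.
move=> c_sym c_perm.
apply: (hankel_ind (P := fun g => _)) => [|a v i j k l ij kl IHv].
  exact: quad0.
have ltN p q : (p < m)%N -> (q < n)%N -> (p + q < N)%N by lia.
rewrite quadD IHv addr0.
have im : (i < m)%N by lia.
have jm : (j < m)%N by lia.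
have kn : (k < n)%N by lia.
have ln : (l < n)%N by lia.
have xE p q (pm : (p < m)%N) (qn : (q < n)%N) :
  x (p + q) = 'X_(Ordinal (ltN p q pm qn)) by rewrite -xvarE.
rewrite (xE _ _ im kn) (xE _ _ im ln) (xE _ _ jm kn) (xE _ _ jm ln).
rewrite quadMl; first by rewrite quadD !quadXX //= -mulrDr c_perm // !mulr0.
  by rewrite mcoeffD !mcoeff0M !mcoeff0XU !mul0r addr0.
move=> b; rewrite mderivD !mderivM !mcoeffD !mcoeff0M !mcoeff0XU.
by rewrite !(mulr0, mul0r, addr0).
Qed.

End Hankel.

(** * The alternating functional of a given weight *)

Section AlternatingForm.
Variable K : fieldType.
Implicit Types (w i j k l m n : nat).

(** The exponent is [|i - j|] halved and rounded down, so the sign alternates along the monomials of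
    weight [w]. *)
Definition altform w i j : K :=
  if (i + j == w)%N then (-1) ^+ ((i - j) + (j - i))./2%N else 0.

Lemma altform_sym w : symmetric2 (altform w).
Proof. by move=> i j; rewrite /altform addnC (addnC (i - j)%N). Qed.

(* A permanent x_(i+k) x_(j+l) + x_(i+l) x_(j+k) of one of these weights has
   j = i + 1 or l = k + 1, so that its two monomials get opposite signs. *)
Lemma altform_permanent w m n i j k l :
  [|| m == 2, w < 4 | 2 * (m + n) <= w + 7]%N ->
  (i < j < m)%N -> (k < l < n)%N ->
  altform w (i + k)%N (j + l)%N + altform w (i + l)%N (j + k)%N = 0.
Proof.
move=> hw ij kl; rewrite /altform.
have -> : (i + l + (j + k) = i + k + (j + l))%N by lia.
case: eqP => [wE|_]; last by rewrite addr0.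
set e := (X in _ ^+ X + _); set e' := (X in _ + _ ^+ X).
(* With [a = j - i] and [b = l - k], the index distances are [a + b] and [|a - b|]; they differ by
   [2 min(a, b) = 2]. *)
have -> : e = e'.+1 by rewrite /e /e'; lia.
by rewrite exprS; ring.
Qed.

End AlternatingForm.

(** * Lower bound: no element of degree 0 or 1 works *)

Section LowerBound.
Variables (K : fieldType) (m n : nat).
Hypothesis char_neq2 : 2%N \notin [pchar K].
Local Notation N := (m + n - 1)%N.
Local Notation x := (xvar K N).
Local Notation I := (permanental_ideal2 (hankel K m n)).

Lemma two_neq0 : 2%:R != 0 :> K.
Proof. by apply: contra char_neq2 => /eqP two0; rewrite inE /= two0 eqxx. Qed.

Lemma ideal_double (J : {pred {mpoly K[N]}}) g :
  is_ideal J -> g + g \in J -> g \in J.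
Proof.
move=> idJ gg; have -> : g = (2%:R^-1)%:MP * (g + g).
  rewrite mulrDr -mulrDl -mpolyCD -mulr2n -(mulr_natr _^-1) mulVf ?two_neq0 //.
  by rewrite mpolyC1 mul1r.
exact: idealMl.
Qed.

(** The functional of weight [b + d] kills [I], and on [x_b f] it only sees the coefficient of
    [x_d], with factor [2] or [-2]. *)
Lemma hankel_coef0 (b : nat) (d : 'I_N) f : (b < N)%N ->
  [|| m == 2, b + d < 4 | 2 * (m + n) <= b + d + 7]%N ->
  x b * f \in I -> f@_U_(d) = 0.
Proof.
move=> bN hw; rewrite -[b]/(val (Ordinal bN)) xvarE.
move/(quad_hankel (@altform_sym K (b + d))) => quad0.
have {quad0} := quad0 (fun i j k l => @altform_permanent K _ m n i j k l hw).
rewrite quadXM; last exact: altform_sym.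
rewrite (bigD1 d) //= big1 ?addr0 => [|j jd].
  rewrite /altform eqxx => /eqP; rewrite !mulf_eq0 (negbTE two_neq0) /=.
  by rewrite signr_eq0 => /eqP.
rewrite /altform eqn_add2l; case: eqP => [jE|]; last by rewrite mul0r.
by case/negP: jd; apply/eqP/val_inj.
Qed.

Hypotheses (m_ge2 : (2 <= m)%N) (n_ge4 : (4 <= n)%N).

Section PrimesOverHankel.
Variable p : {pred {mpoly K[N]}}.
Hypotheses (prime_p : prime_ideal p) (I_sub_p : {subset I <= p}).

Lemma prime_is_ideal : is_ideal p.
Proof. by case: prime_p => [[p0 _ pD] _]; split=> // a u v; exact: pD. Qed.

Lemma prime_sqr u : u * u \in p -> u \in p.
Proof. by case: prime_p => _ /[apply] /orP[]. Qed.

Let pD := idealD prime_is_ideal.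
Let pB := idealB prime_is_ideal.
Let pMl := idealMl prime_is_ideal.

(* In each of the weights 2i-1, 2i, 2i+1 the adjacent permanents make all
   monomials agree up to sign, and rewriting x_i^3 with them gives -x_i^3. *)
Lemma inner_var_in_prime i : (2 <= i)%N -> (i + 3 <= N)%N -> x i \in p.
Proof.
move=> i2 iN; have [j jE] : exists j, i = j.+2 by exists (i - 2)%N; lia.
rewrite {}jE in i2 iN *.
have r1 : x j * x j.+4 + x j.+1 * x j.+3 \in p.
  by apply/I_sub_p/hankel_adjacent; lia.
have r2 : x j.+1 * x j.+3 + x j.+2 * x j.+2 \in p.
  by apply/I_sub_p/hankel_adjacent; lia.
have r3 : x j * x j.+3 + x j.+1 * x j.+2 \in p.
  by apply/I_sub_p/hankel_adjacent; lia.
have r4 : x j.+2 * x j.+4 + x j.+3 * x j.+3 \in p.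
  by apply/I_sub_p/hankel_adjacent; lia.
suff : x j.+2 * (x j.+2 * x j.+2) \in p.
  by case: prime_p => _ prime_pM /prime_pM /orP[|/prime_sqr].
apply: ideal_double; first exact: prime_is_ideal.
(* With [i = j + 2], this combination of [r1], ..., [r4] equals [2 x_i^3]. *)
have := pD (pB (pMl (x j.+2) (pD r2 r2)) (pMl (x j.+3) r3))
  (pB (pMl (x j) r4) (pMl (x j.+2) r1)).
congr (_ \in p); ring.
Qed.

(** For [i = 1] and [i = N - 2], modulo [p] the square of [x_i] is minus the product of its two
    neighbours, one of which is an inner variable. *)
Lemma var_in_prime i : (1 <= i)%N -> (i + 2 <= N)%N -> x i \in p.
Proof.
move=> i1 iN.
have [/andP[]|ends] := boolP (2 <= i <= N - 3)%N.
  by move=> i2 i3; apply: inner_var_in_prime; lia.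
have [j jE] : exists j, i = j.+1 by exists i.-1; lia.
rewrite {}jE in ends i1 iN *.
have r : x j * x j.+2 + x j.+1 * x j.+1 \in p.
  by apply/I_sub_p/hankel_adjacent; lia.
suff xx : x j * x j.+2 \in p.
  by apply: prime_sqr; have := pB r xx; rewrite addrC addKr.
have [j0|j0] := posnP j.
  by apply: pMl; apply: inner_var_in_prime; lia.
by rewrite mulrC; apply: pMl; apply: inner_var_in_prime; lia.
Qed.

(** The permanent of the four corners is [x_0 x_(N-1) + x_(n-1) x_(m-1)], and [x_(m-1)] is in
    [p]. *)
Lemma end_var_in_prime : (x 0 \in p) || (x N.-1 \in p).
Proof.
case: prime_p => _; apply.
have hm : (0 < m.-1 < m)%N by lia.
have hn : (0 < n.-1 < n)%N by lia.
have := I_sub_p (hankel_permanent K hm hn); rewrite !add0n addn0.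
have -> : (m.-1 + n.-1 = N.-1)%N by lia.
move=> r; have xx : x n.-1 * x m.-1 \in p.
  by apply: pMl; apply: var_in_prime; lia.
by have := pB r xx; rewrite addrK.
Qed.

End PrimesOverHankel.

Lemma v_degree_ge2 d :
  [\/ m = 2, (m + n <= 7)%N | (m + n = 8)%N] -> v_degree I d -> (2 <= d)%N.
Proof.
move=> cases [f [p [f_homog [prime_p _] colonE]]]; rewrite leqNgt.
apply/negP => d_lt2.
have idI := hankel_ideal K m n.
have I_sub_p : {subset I <= p}.
  by move=> u Iu; rewrite -colonE in_colon; apply: idealMr.
have pE i : x i \in p -> x i * f \in I by rewrite -colonE in_colon.
have x_in i i1 iN := pE i (var_in_prime prime_p I_sub_p i1 iN).
have end_in := end_var_in_prime prime_p I_sub_p.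
suff f0 : f = 0.
  have [[_ /negP p1 _] _] := prime_p; case: p1.
  by rewrite -colonE in_colon f0 mulr0 ideal0.
have N1 : (1 < N)%N by lia.
apply/mpolyP => mm; rewrite mcoeff0.
have [mmd|mmd] := eqVneq (mdeg mm) d; last exact: (dhomog_nemf_coeff f_homog).
have x1f : x 1 * f \in I by apply: x_in; lia.
(* The constant term of [f] is the coefficient of [x_1] in [x_1 f], and elements of [I] have no
   linear terms. *)
have [mm0|mm_gt0] := posnP (mdeg mm).
  have := mderiv_mcoeff0_hankel (Ordinal N1) x1f.
  rewrite -[1%N]/(val (Ordinal N1)) xvarE mderivM mderivXU eqxx.
  rewrite mcoeffD !mcoeff0M mcoeff0XU mul0r addr0 mcoeffC eqxx !mul1r.
  by move/eqP: mm0; rewrite mdeg_eq0 => /eqP ->.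
have /eqP/mdeg1P [j /eqP ->] : mdeg mm = 1%N by lia.
have jN := ltn_ord j.
(* Multiplying by [x_1] settles [m = 2] and [j <= 2]; multiplying by [x_(N-2)] settles
   [j >= N - 3]. *)
have [ends|mid] := boolP [|| m == 2, j <= 2 | N <= j + 3]%N.
  have [h|h] := boolP [|| m == 2 | j <= 2]%N.
    by apply: (hankel_coef0 _ _ x1f); lia.
  by apply: (@hankel_coef0 (N - 2) j f); [lia|lia|apply: x_in; lia].
(* What remains is [x_3] with [N = 7]; either end variable settles it, in weight 3 or 9. *)
have j3 : j = 3 :> nat by case: cases; lia.
have N7 : (m + n = 8)%N by case: cases; lia.
case/orP: end_in => /pE; apply: hankel_coef0; lia.
Qed.

End LowerBound.

(** * Upper bound: recognising a prime colon ideal *)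

Lemma rmorph_congr_ideal (K : fieldType) (N : nat) (J : {pred {mpoly K[N]}})
    (u : {rmorphism {mpoly K[N]} -> {mpoly K[N]}}) (g : {mpoly K[N]}) :
  is_ideal J -> (forall c, u c%:MP = c%:MP) ->
  (forall i, 'X_i - u 'X_i \in J) -> g - u g \in J.
Proof.
move=> idJ uC uX.
pose P h := h - u h \in J.
have PC c : P c%:MP by rewrite /P uC subrr ideal0.
have PM h k : P h -> P k -> P (h * k).
  move=> Ph Pk; rewrite /P rmorphM /=.
  have -> : h * k - u h * u k = h * (k - u k) + (h - u h) * u k by ring.
  by apply: idealD => //; [exact: idealMl | exact: idealMr].
elim/mpolyind: g => [|c mm g _ _ Pg]; first by rewrite rmorph0 subr0 ideal0.
rewrite rmorphD opprD addrACA; apply: idealD => //.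
rewrite -mul_mpolyC; apply: (PM) => //; rewrite mpolyXE_id.
apply: (big_ind P) => [||i _]; [by rewrite -mpolyC1 | exact: PM |].
elim: (mm i) => [|e IHe]; first by rewrite expr0 -mpolyC1.
by rewrite exprS; apply: PM => //; exact: uX.
Qed.

Section UpperBound.
Variables (K : fieldType) (N : nat) (I : {pred {mpoly K[N]}}).
Hypothesis idealI : is_ideal I.

(** The kernel of a map to a domain is prime, and [f] itself witnesses that it is associated. *)
Lemma v_degree_kernel (S : idomainType) (s : {rmorphism {mpoly K[N]} -> S})
    d f : f \is d.-homog -> (forall g, g * f \in I <-> s g = 0) ->
  v_degree I d.
Proof.
move=> f_homog colonE; pose p : {pred {mpoly K[N]}} := fun g => s g == 0.
have pE g : (g \in p) = (s g == 0) by [].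
have pcolon : p =i colon I f.
  by move=> g; rewrite pE in_colon; apply/eqP/idP => /colonE.
exists f, p; split=> //.
split; last by exists f.
split; first split.
- by rewrite pE rmorph0.
- by rewrite pE rmorph1 oner_eq0.
- move=> a u v; rewrite !pE => /eqP u0 /eqP v0.
  by rewrite rmorphD rmorphM u0 v0 mulr0 addr0.
by move=> u v; rewrite !pE rmorphM mulf_eq0.
Qed.

Lemma v_degree_socle d f : f \is d.-homog -> f \notin I ->
  (forall i : 'I_N, 'X_i * f \in I) -> v_degree I d.
Proof.
move=> f_homog fNI Xf.
have congr0 g : g - (g@_0%MM)%:MP \in colon I f.
  apply: (@rmorph_congr_ideal _ _ _ (@mpolyC N K \o mcoeff 0%MM)).
  - exact: ideal_colon.
  - by move=> c /=; rewrite mcoeffC eqxx mulr1.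
  - by move=> i; rewrite /= mcoeff0XU mpolyC0 subr0 in_colon.
apply: (@v_degree_kernel K (mcoeff 0%MM) d f) => // g; split=> [gf|g0].
  (* Modulo the colon ideal [g] is its constant term; if that is a unit, [f] lies in [I]. *)
  apply: contraNeq fNI => g0.
  have := idealB idealI gf (congr0 g); rewrite mulrBl opprB addrCA subrr addr0.
  move=> /(idealMl idealI (g@_0%MM)^-1%:MP).
  by rewrite mulrA -mpolyCM mulVf // mpolyC1 mul1r.
by have := congr0 g; rewrite g0 mpolyC0 subr0 in_colon.
Qed.

Lemma v_numberE d : v_degree I d -> (forall e, v_degree I e -> (d <= e)%N) ->
  v_number I = d.
Proof.
move=> vd min_d; rewrite /v_number; case: pselect => [ex_d|]; last first.
  by case; exists d; apply/asboolP.
case: ex_minnP => e /asboolP ve min_e; apply/eqP.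
by rewrite eqn_leq min_d // andbT; apply: min_e; apply/asboolP.
Qed.

End UpperBound.

(** * Socle elements of degree two *)

Section SocleElements.
Variables (K : fieldType) (m n : nat).
Hypothesis char_neq2 : 2%N \notin [pchar K].
Local Notation N := (m + n - 1)%N.
Local Notation x := (xvar K N).
Local Notation I := (permanental_ideal2 (hankel K m n)).

Lemma xvarM_homog a b : x a * x b \is 2.-homog.
Proof.
have x1 c : x c \is 1.-homog.
  rewrite /xvar; case: insub => [i|]; last exact: dhomog0.
  by rewrite dhomogX /= mdeg1.
exact: (dhomogM (x1 a) (x1 b)).
Qed.

Let ID := idealD (hankel_ideal K m n).
Let IB := idealB (hankel_ideal K m n).
Let IM := idealMl (hankel_ideal K m n).

Lemma quad_notin (c : nat -> nat -> K) a b : (a < N)%N -> (b < N)%N ->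
  symmetric2 c ->
  (forall i j k l, (i < j < m)%N -> (k < l < n)%N ->
     c (i + k)%N (j + l)%N + c (i + l)%N (j + k)%N = 0) ->
  c a b != 0 -> x a * x b \notin I.
Proof.
move=> aN bN c_sym c_perm cab; apply/negP => /(quad_hankel c_sym c_perm).
rewrite -[a]/(val (Ordinal aN)) -[b]/(val (Ordinal bN)) !xvarE quadXX //.
by move/eqP; rewrite mulf_eq0 (negbTE (two_neq0 char_neq2)) (negbTE cab).
Qed.

Section TwoRows.
Hypothesis m2 : m = 2.

Lemma two_row_permanent k l : (k < n)%N -> (l < n)%N -> k != l ->
  x k * x l.+1 + x k.+1 * x l \in I.
Proof.
move=> kn ln kl; wlog kl' : k l kn ln {kl} / (k < l)%N => [H|].
  have [|lk|kE] := ltngtP k l; [exact: H| |by rewrite kE eqxx in kl].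
  by have := H l k ln kn lk; congr (_ \in I); ring.
have hm : (0 < 1 < m)%N by lia.
have hn : (k < l < n)%N by lia.
have := hankel_permanent K hm hn; rewrite !add0n !add1n.
by congr (_ \in I); ring.
Qed.

(** Moving the odd entry once around the three columns takes three sign changes, so each product
    equals its own negative modulo [I]. *)
Lemma two_row_cubic i j k : (i < n)%N -> (j < n)%N -> (k < n)%N ->
  i != j -> i != k -> j != k ->
  x i * x j * x k.+1 \in I /\ x i.+1 * x j.+1 * x k \in I.
Proof.
move=> hi hj hk ij ik jk.
have rij := two_row_permanent hi hj ij.
have rik := two_row_permanent hi hk ik.
have rjk := two_row_permanent hj hk jk.
have idI := hankel_ideal K m n.
split; apply: (ideal_double char_neq2 idI).
  have := ID (IB (IM (x i) rjk) (IM (x k) rij)) (IM (x j) rik).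
  by congr (_ \in I); ring.
have := ID (IB (IM (x i.+1) rjk) (IM (x k.+1) rij)) (IM (x j.+1) rik).
by congr (_ \in I); ring.
Qed.

Lemma two_row_v_degree : (4 <= n)%N -> v_degree I 2.
Proof.
move=> n4; apply: (v_degree_socle (hankel_ideal K m n) (xvarM_homog 2 2)).
  apply: (@quad_notin (altform K 4)); try lia; first exact: altform_sym.
    by move=> i j k l; apply: altform_permanent; rewrite m2.
  by rewrite /altform /= oner_eq0.
move=> i; rewrite -xvarE; have := ltn_ord i; move: (val i) => {}i iN.
(* Modulo [I], [x_2^2] is [- x_1 x_3], which splits over different columns and so fits
   [two_row_cubic]. *)
have r : x 1 * x 3 + x 2 * x 2 \in I by apply: two_row_permanent; lia.
suff xx : x i * (x 1 * x 3) \in I.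
  by have := IB (IM (x i) r) xx; rewrite -mulrBr addrC addKr.
have [i1|i1] := eqVneq i 1.
  have s : x 0 * x 4 + x 1 * x 3 \in I by apply: two_row_permanent; lia.
  have [h _] : x 0 * x 1 * x 4 \in I /\ x 1 * x 2 * x 3 \in I.
    by apply: two_row_cubic; lia.
  by rewrite i1; have := IB (IM (x 1) s) h; congr (_ \in I); ring.
have [i2|i2] := eqVneq i 2.
  have [h _] : x 2 * x 3 * x 1 \in I /\ x 3 * x 4 * x 0 \in I.
    by apply: two_row_cubic; lia.
  by rewrite i2; move: h; congr (_ \in I); ring.
(* The last variable [x_n] occurs only in the bottom row, hence the second half of
   [two_row_cubic]. *)
have [i_n|i_n] := eqVneq i n.
  have [n' iE] : exists n', i = n'.+1 by exists i.-1; lia.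
  have [_ h] : x 2 * x n' * x 2 \in I /\ x 3 * x n'.+1 * x 1 \in I.
    by apply: two_row_cubic; lia.
  by rewrite iE; move: h; congr (_ \in I); ring.
have [h _] : x i * x 1 * x 3 \in I /\ x i.+1 * x 2 * x 2 \in I.
  by apply: two_row_cubic; lia.
by rewrite mulrA.
Qed.

End TwoRows.

Section ThreeRows.
Hypotheses (m_ge3 : (3 <= m)%N) (n_ge4 : (4 <= n)%N).

(** A third row gives a permanent two steps wide, so these three monomials have pairwise sums in
    [I]; as 2 is invertible, each lies in [I]. *)
Lemma even_weight_vanish j : (j + 4 < N)%N ->
  [/\ x j * x j.+4 \in I, x j.+1 * x j.+3 \in I & x j.+2 * x j.+2 \in I].
Proof.
move=> jN.
have r1 : x j * x j.+4 + x j.+1 * x j.+3 \in I.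
  by apply: hankel_adjacent; lia.
have r2 : x j.+1 * x j.+3 + x j.+2 * x j.+2 \in I.
  by apply: hankel_adjacent; lia.
have r3 : x j * x j.+4 + x j.+2 * x j.+2 \in I.
  pose i := minn j (m - 3).
  have hi : (i < i + 2 < m)%N by lia.
  have hk : (j - i < j - i + 2 < n)%N by lia.
  have := hankel_permanent K hi hk.
  have -> : (i + (j - i) = j)%N by lia.
  have -> : (i + 2 + (j - i + 2) = j.+4)%N by lia.
  have -> : (i + (j - i + 2) = j.+2)%N by lia.
  by have -> : (i + 2 + (j - i) = j.+2)%N by lia.
have dbl := ideal_double char_neq2 (hankel_ideal K m n).
split; apply: dbl.
- by have := ID (IB r1 r2) r3; congr (_ \in I); ring.
- by have := IB (ID r1 r2) r3; congr (_ \in I); ring.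
- by have := ID (IB r2 r1) r3; congr (_ \in I); ring.
Qed.

(** [altform 5] fails for three rows: it is [1] on both terms of the permanent [x_0 x_5 + x_2 x_3].
    Here [x_2 x_3] alone gets [1]. *)
Definition middleform i j : K :=
  if (i + j == 5)%N then (if (i == 2) || (j == 2) then 1 else -1) else 0.

Lemma middle_v_degree : (n <= 4)%N -> (m <= 4)%N -> v_degree I 2.
Proof.
move=> n4 m4; apply: (v_degree_socle (hankel_ideal K m n) (xvarM_homog 2 3)).
  apply: (@quad_notin middleform); try lia.
  - by move=> i j; rewrite /middleform addnC orbC.
  - move=> i j k l ij kl; rewrite /middleform.
    have -> : (i + l + (j + k) = i + k + (j + l))%N by lia.
    case: eqP => [wE|_]; last by rewrite addr0.
    (* For [m, n <= 4], every permanent of weight 5 has [x_2 x_3] as exactly one of its terms, the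
       antidiagonal one. *)
    have -> : ((i + k == 2) || (j + l == 2))%N = false by lia.
    have -> : ((i + l == 2) || (j + k == 2))%N by lia.
    by rewrite addNr.
  - by rewrite /middleform /= oner_eq0.
have [_ h13 h22] := @even_weight_vanish 0 ltac:(lia).
have [_ h24 h33] := @even_weight_vanish 1 ltac:(lia).
move=> i; rewrite -xvarE; have := ltn_ord i; move: (val i) => {}i iN.
have : (i < 7)%N by lia.
case: i iN => [|[|[|[|[|[|[|]]]]]]] // iN _.
- have r : x 0 * x 2 + x 1 * x 1 \in I by apply: hankel_adjacent; lia.
  by have := IB (IM (x 3) r) (IM (x 1) h13); congr (_ \in I); ring.
- by have := IM (x 2) h13; congr (_ \in I); ring.
- by have := IM (x 3) h22; congr (_ \in I); ring.
- by have := IM (x 2) h33; congr (_ \in I); ring.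
- by have := IM (x 3) h24; congr (_ \in I); ring.
- have r : x 3 * x 5 + x 4 * x 4 \in I by apply: hankel_adjacent; lia.
  by have := IB (IM (x 2) r) (IM (x 4) h24); congr (_ \in I); ring.
- have r : x 3 * x 6 + x 4 * x 5 \in I by apply: hankel_adjacent; lia.
  by have := IB (IM (x 2) r) (IM (x 5) h24); congr (_ \in I); ring.
Qed.

End ThreeRows.

End SocleElements.

(** * The 3 by 5 matrix *)

Section ThreeFive.
Variable K : fieldType.
Hypothesis char_neq2 : 2%N \notin [pchar K].
Local Notation x := (xvar K (3 + 5 - 1)).
Local Notation P := {mpoly K[3 + 5 - 1]}.
Local Notation I := (permanental_ideal2 (hankel K 3 5)).

(* 'X%:P is t and 'X is s; the sign at i = 2 makes the permanents
   x_0 x_2 + x_1^2 and x_0 x_3 + x_1 x_2 vanish, and all the others have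
   weight at least 4. *)
Definition jet_point (i : 'I_(3 + 5 - 1)) : {poly {poly K}} :=
  (-1) ^+ (i == 2 :> nat) * 'X%:P * 'X^i.

Definition jet : P -> {poly {poly K}} := mmap (polyC \o polyC) jet_point.

HB.instance Definition _ := GRing.RMorphism.on jet.

Lemma jet_xvar k : (k < 7)%N ->
  jet (x k) = (-1) ^+ (k == 2) * 'X%:P * 'X^k.
Proof.
move=> k7; rewrite -[k]/(val (Ordinal (k7 : (k < 3 + 5 - 1)%N))) xvarE.
by rewrite /jet mmapX mmap1U.
Qed.

(** Divisibility by ['X^4] stands for vanishing in the quotient by [s^4]. *)
Lemma jet_hankel g : g \in I -> exists q, jet g = q * 'X^4.
Proof.
apply: (hankel_ind (P := fun g => _)) => [|a v i j k l ij kl [q vE]].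
  by exists 0; rewrite rmorph0 mul0r.
rewrite rmorphD rmorphM rmorphD !rmorphM /= !jet_xvar; try lia.
rewrite {}vE.
have [w4|w3] := leqP 4 (i + j + k + l).
  exists (jet a * (((-1) ^+ (i + k == 2) * (-1) ^+ (j + l == 2)
     + (-1) ^+ (i + l == 2) * (-1) ^+ (j + k == 2)) * 'X%:P * 'X%:P
     * 'X^(i + j + k + l - 4)) + q).
  have XE p r : (p + r = i + j + k + l)%N ->
    'X^p * 'X^r = 'X^(i + j + k + l - 4) * 'X^4 :> {poly {poly K}}.
    by move=> prE; rewrite -!exprD subnK // prE.
  have e1 := XE (i + k)%N (j + l)%N ltac:(lia).
  have e2 := XE (i + l)%N (j + k)%N ltac:(lia).
  transitivity (jet a * ('X%:P * 'X%:P) *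
    ((-1) ^+ (i + k == 2) * (-1) ^+ (j + l == 2) * ('X^(i + k) * 'X^(j + l))
    + (-1) ^+ (i + l == 2) * (-1) ^+ (j + k == 2)
      * ('X^(i + l) * 'X^(j + k))) + q * 'X^4); first by ring.
  by rewrite e1 e2; ring.
exists q; have -> : i = 0 by lia.
have -> : k = 0 by lia.
have [[-> ->]|[[-> ->]|[-> ->]]] :
    (j = 1 /\ l = 1) \/ (j = 1 /\ l = 2) \/ (j = 2 /\ l = 1) by lia.
all: by rewrite /=; ring.
Qed.

(** Setting [s = 0] sends [x_0] to [t] and every other variable to 0, so the kernel is
    [(x_1, ..., x_6)]. *)
Definition axis_eval : P -> {poly K} := horner_eval 0 \o jet.

HB.instance Definition _ := GRing.RMorphism.on axis_eval.

(** Substituting [x_0] for [t] turns [axis_eval] into an endomorphism, as [rmorph_congr_ideal]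
    requires. *)
Definition axis_proj : P -> P :=
  horner_eval (x 0) \o map_poly (@mpolyC (3 + 5 - 1) K) \o axis_eval.

HB.instance Definition _ := GRing.RMorphism.on axis_proj.

Lemma axis_evalC c : axis_eval c%:MP = c%:P.
Proof. by rewrite /axis_eval /= /jet mmapC /= /horner_eval hornerC. Qed.

Lemma axis_eval_xvar k : (k < 7)%N ->
  axis_eval (x k) = if k == 0 then 'X else 0.
Proof.
move=> k7; rewrite /axis_eval /= jet_xvar // /horner_eval !hornerM hornerXn.
rewrite hornerC; case: k k7 => [|k] _; last by rewrite expr0n mulr0.
by rewrite !expr0 hornerC mulr1 mul1r.
Qed.

Lemma axis_projC c : axis_proj c%:MP = c%:MP.
Proof.
by rewrite /axis_proj [LHS]/= axis_evalC map_polyC /= /horner_eval hornerC.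
Qed.

Lemma axis_proj_xvar k : (k < 7)%N ->
  axis_proj (x k) = if k == 0 then x 0 else 0.
Proof.
move=> k7; rewrite /axis_proj [LHS]/= axis_eval_xvar //.
case: eqP => _; first by rewrite map_polyX /horner_eval hornerX.
by rewrite rmorph0 /horner_eval horner0.
Qed.

Lemma three_five_v_degree : v_degree I 2.
Proof.
have idI := hankel_ideal K 3 5.
have [h04 h13 h22] := @even_weight_vanish K 3 5 char_neq2 isT isT 0 isT.
have [_ h24 h33] := @even_weight_vanish K 3 5 char_neq2 isT isT 1 isT.
have [_ h35 _] := @even_weight_vanish K 3 5 char_neq2 isT isT 2 isT.
(* With five columns, [x_0 x_5], [x_1 x_4] and [x_2 x_3] have all pairwise sums in [I]. *)
have h23 : x 2 * x 3 \in I.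
  have r1 : x 0 * x 5 + x 4 * x 1 \in I :=
    @hankel_permanent K 3 5 0 1 0 4 isT isT.
  have r2 : x 1 * x 4 + x 2 * x 3 \in I :=
    @hankel_adjacent K 3 5 1 3 isT isT isT isT.
  have r3 : x 0 * x 5 + x 3 * x 2 \in I :=
    @hankel_permanent K 3 5 0 2 0 3 isT isT.
  apply: (ideal_double char_neq2 idI).
  by have := idealD idI (idealB idI r2 r1) r3; congr (_ \in I); ring.
have h06 : x 0 * x 6 \in I.
  have r : x 0 * x 6 + x 4 * x 2 \in I :=
    @hankel_permanent K 3 5 0 2 0 4 isT isT.
  by have := idealB idI r h24; congr (_ \in I); ring.
have colonX i : (0 < i < 7)%N -> x i * (x 0 * x 3) \in I.
  case: i => [|[|[|[|[|[|[|]]]]]]] // _.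
  - by have := idealMl idI (x 0) h13; congr (_ \in I); ring.
  - by have := idealMl idI (x 0) h23; congr (_ \in I); ring.
  - by have := idealMl idI (x 0) h33; congr (_ \in I); ring.
  - by have := idealMl idI (x 3) h04; congr (_ \in I); ring.
  - by have := idealMl idI (x 0) h35; congr (_ \in I); ring.
  - by have := idealMl idI (x 3) h06; congr (_ \in I); ring.
apply: (v_degree_kernel (s := axis_eval) (xvarM_homog K 3 5 0 3)) => g.
split=> [/jet_hankel [q]|g0].
  (* The image of [g x_0 x_3] is [jet g * t^2 s^3], a multiple of [s^4]; cancel [s^3], then set
     [s = 0]. *)
  rewrite !rmorphM /= !jet_xvar // !expr0 !mul1r mulr1 => gE.
  have X3 : 'X^3 != 0 :> {poly {poly K}} by rewrite -size_poly_gt0 size_polyXn.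
  have {}gE : jet g * ('X%:P * 'X%:P) = q * 'X.
    by apply: (mulIf X3); rewrite -mulrA -[RHS]mulrA -exprS -gE; ring.
  have := congr1 (horner_eval 0) gE.
  rewrite /horner_eval !hornerM hornerX mulr0 hornerC => /eqP.
  by rewrite !mulf_eq0 polyX_eq0 !orbF => /eqP.
(* Conversely, [g] agrees with [axis_proj g] modulo the colon ideal, and [axis_proj g] is 0 when
   [axis_eval g] is. *)
have : g - axis_proj g \in colon I (x 0 * x 3).
  apply: rmorph_congr_ideal; [exact: ideal_colon | exact: axis_projC |] => i.
  rewrite -xvarE -[_ - _]/(x i - axis_proj (x i)) axis_proj_xvar // in_colon.
  case: eqP => [->|i0]; first by rewrite subrr mul0r ideal0.
  by rewrite subr0; apply: colonX; have := ltn_ord i; lia.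
rewrite /axis_proj /= g0 rmorph0 /horner_eval horner0 subr0.
by rewrite in_colon.
Qed.

End ThreeFive.

(** * The v-number in the four cases *)

Theorem theorem5p2 (K : fieldType) (m n : nat)
    (char_neq2 : 2%N \notin [pchar K]%R)
    (m_ge2 : (2 <= m)%N) (m_le_n : (m <= n)%N)
    (cases : [\/ m = 2%N /\ (4 <= n)%N,
                 m = 3%N /\ n = 4%N,
                 m = 3%N /\ n = 5%N |
                 m = 4%N /\ n = 4%N]) :
  v_number (permanental_ideal2 (hankel K m n)) = 2%N.
Proof.
apply: v_numberE => [|e]; last first.
  apply: v_degree_ge2 => //; first by case: cases; lia.
  by case: cases => -[mE nE];
    [apply: Or31 | apply: Or32 | apply: Or33 | apply: Or33]; lia.
case: cases => -[m_eq n_eq].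
- exact: two_row_v_degree.
- by apply: middle_v_degree; lia.
- by rewrite m_eq n_eq; exact: three_five_v_degree.
- by apply: middle_v_degree; lia.
Qed.
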